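(* Let $\pi_t$ be the law at time $t$ of the symmetric Ehrenfest chain with $n$ balls started with all $n$ balls in urn $a$ (that is, from state $n$). For every $n\ge1$, $t\ge0$, and $k\in\{0,\dots,n\}$, $$\pi_t(k)=\bigl|\langle m=k-\tfrac n2|\,e^{-i\theta(t)J_x}\,|m=+\tfrac n2\rangle\bigr|^{2},\qquad \theta(t)=\arccos\bigl(e^{-2t}\bigr).$$
   Context: The symmetric Ehrenfest urn with $n$ balls is the continuous-time Markov chain on $\{0,\dots,n\}$ (the state $k$ counts the balls in urn $a$) with generator $Q_{k,k-1}=k$, $Q_{k,k+1}=n-k$, $Q_{kk}=-n$, all other entries zero; its law is the column vector $\pi_t=e^{tQ^{T}}\pi_0$. The standard basis of $\mathbb{C}^{n+1}$ is labelled either by $k\in\{0,\dots,n\}$ or by $m=k-\tfrac n2$ (same vector). $J_x$ is the spin-$\tfrac n2$ matrix: real symmetric tridiagonal with zero diagonal and $(J_x)_{k+1,k}=\tfrac12\sqrt{(k+1)(n-k)}$. *)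

(* Defs.v *)
From mathcomp Require Import all_boot all_order all_algebra.
From mathcomp Require Import all_classical all_reals all_analysis.
From mathcomp.real_closed Require Import complex.

Set Implicit Arguments.
Unset Strict Implicit.
Unset Printing Implicit Defensive.

Import Order.TTheory GRing.Theory Num.Theory.
Import numFieldNormedType.Exports.

Local Open Scope classical_set_scope.
Local Open Scope ring_scope.
Local Open Scope complex_scope.
Local Open Scope sesquilinear_scope.

(* The limit is taken for the sup norm on matrices, K being R or R[i]. *)
Definition expmx (K : numFieldType) (n : nat) (A : 'M[K]_n.+1) : 'M[K]_n.+1 :=
  limn (series (fun j : nat => (j`!%:R)^-1 *: A ^+ j)).

Definition ehrenfestQ (R : realType) (n : nat) : 'M[R]_n.+1 :=
  \matrix_(i, j) if (i == j.+1 :> nat)%N then i%:R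
                 else if (j == i.+1 :> nat)%N then n%:R - i%:R
                 else if i == j then - n%:R
                 else 0.

Definition ehrenfest_law (R : realType) (n : nat) (pi0 : 'cV[R]_n.+1) (t : R) :
  'cV[R]_n.+1 := expmx (t *: (ehrenfestQ R n)^T) *m pi0.

Definition spinJx (R : realType) (n : nat) : 'M[R]_n.+1 :=
  \matrix_(i, j)
    if (i == j.+1 :> nat)%N then Num.sqrt ((j%:R + 1) * (n%:R - j%:R)) / 2
    else if (j == i.+1 :> nat)%N then Num.sqrt ((i%:R + 1) * (n%:R - i%:R)) / 2
    else 0.

(* Basis vectors carry their magnetic label m = k - n/2; for any other real m
   this is the zero vector. *)
Definition ket (R : realType) (n : nat) (m : R) : 'cV[R[i]]_n.+1 :=
  \col_(k < n.+1) (k%:R - n%:R / 2 == m)%:R.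

Definition braket (R : realType) (n : nat) (m : R) (U : 'M[R[i]]_n.+1) (m' : R)
  : R[i] := ((ket n m)^t* *m U *m ket n m') 0 0.

(* Main.v *)
Require Import Defs.
From mathcomp Require Import all_boot all_order all_algebra.
From mathcomp Require Import all_classical all_reals all_analysis.
From mathcomp.real_closed Require Import complex.
From mathcomp Require Import ring lra zify.

(** Both sides are matrix exponentials of the same Kac matrix, evaluated in
    closed form by diagonalising it.  Encode a column vector as the polynomial
    whose coefficients are its entries.  Then [Q^T] acts as the first-order
    operator [p |-> (1 - X^2) p' + (n X - n) p], whose eigenvectors are
    [(1 - X)^l (1 + X)^(n - l)] with eigenvalues [- 2 l] ([kpoly_ode],
    [ehrenfestQ_kmx]).  These are the columns of the Krawtchouk matrix [K],
    which satisfies [K^2 = 2^n] ([kmx_sqr]), so the diagonalisation is explicit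
    and the exponential series can be summed on each eigenvalue
    ([expmx_diag]).

    If the exponentiated eigenvalues have the form [x^(n - l) y^l], column [n] of
    [2^(-n) K diag(x^(n - l) y^l) K] is the expansion of
    [((x + y) X / 2 + (x - y) / 2)^n] ([kmx_diag_kmx_max]).  For the urn,
    [x = 1] and [y = e^(-2t)], which gives the binomial law with parameter
    [(1 + e^(-2t)) / 2].  On the spin side, [2 J_x] is the conjugate of
    [Q^T + n] by the square roots of the binomial coefficients
    ([sqrt_bin_spinJx]), and [x, y = e^(-/+ i theta / 2)] gives the amplitude
    [sqrt C(n, k) cos(theta/2)^k (- i sin(theta/2))^(n - k)].  Its squared
    modulus is the binomial law with parameter
    [cos^2 (theta/2) = (1 + cos theta) / 2], and [cos theta = e^(-2t)]. *)

Import Order.TTheory GRing.Theory Num.Theory.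
Import numFieldNormedType.Exports.

Local Open Scope ring_scope.
Local Open Scope complex_scope.

(** * Exponentials of diagonalisable matrices *)

Lemma cvg_mx_entry (T : topologicalType) (m n : nat) (U : Type)
    (F : set_system U) (FF : Filter F) (f : U -> 'M[T]_(m, n)) (M : 'M[T]_(m, n)) :
  (forall i j, (fun x => f x i j) @ F --> M i j)%classic ->
  (f @ F --> M)%classic.
Proof.
move=> fM A [P MP sPA].
have FP : (\forall x \near F,
    forall ij : 'I_m * 'I_n, P ij.1 ij.2 (f x ij.1 ij.2))%classic.
  by apply: filter_forall => -[i j] /=; apply: (fM i j); exact: MP.
by apply: filterS FP => x Px; apply: sPA => i j; exact: (Px (i, j)).
Qed.

(** Convergence of the scalar series on the eigenvalues is taken as a hypothesis,
    which avoids any completeness requirement on [K]: every partial sum is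
    [P diag(partial sums) P^-1], so its entries converge. *)
Lemma expmx_diag (K : numFieldType) (n : nat) (A P Q : 'M[K]_n.+1)
    (d e : 'rV[K]_n.+1) :
  P *m Q = 1%:M -> Q *m P = 1%:M -> A *m P = P *m diag_mx d ->
  (forall l, series (fun j => (j`!%:R)^-1 * d 0 l ^+ j) @ \oo --> e 0 l)%classic ->
  expmx A = P *m diag_mx e *m Q.
Proof.
move=> PQ QP AP cv.
have pow j : A ^+ j = P *m diag_mx (\row_l d 0 l ^+ j) *m Q.
  elim: j => [|j IH].
    have -> : diag_mx (\row_l d 0 l ^+ 0) = 1%:M :> 'M[K]_n.+1.
      by apply/matrixP => a b; rewrite !mxE expr0.
    by rewrite expr0 mulmx1 PQ.
  rewrite exprS IH -mulmxE !mulmxA AP -(mulmxA P) mulmx_diag.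
  congr (P *m diag_mx _ *m Q).
  by apply/rowP => l; rewrite !mxE exprS.
apply: cvg_lim; first exact: norm_hausdorff.
apply: cvg_mx_entry => a b.
have -> : (P *m diag_mx e *m Q) a b = \sum_l P a l * e 0 l * Q l b.
  by rewrite mxE; apply: eq_bigr => l _; rewrite mul_mx_diag mxE.
under eq_fun => N.
  have -> : series (fun j : nat => (j`!%:R)^-1 *: A ^+ j) N a b =
      \sum_l P a l * series (fun j => (j`!%:R)^-1 * d 0 l ^+ j) N * Q l b.
    rewrite /series /= summxE.
    under [RHS]eq_bigr do rewrite mulr_sumr mulr_suml.
    rewrite exchange_big /=; apply: eq_bigr => j _.
    rewrite pow mxE mxE mulr_sumr; apply: eq_bigr => l _.
    by rewrite mul_mx_diag !mxE; ring.
  over.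
apply: cvg_big => [|l _]; first exact: add_continuous.
by apply: cvgMr_tmp; apply: cvgMl_tmp; exact: cv.
Qed.

(** * Krawtchouk polynomials *)

Section Krawtchouk.
Variable F : fieldType.
Implicit Types p u v : {poly F}.

Definition kpoly (a b : nat) : {poly F} := (1 - 'X) ^+ a * (1 + 'X) ^+ b.

Lemma kpolySl a b : kpoly a.+1 b = kpoly a b * (1 + (-1) *: 'X).
Proof. by rewrite /kpoly exprSr scaleN1r mulrAC. Qed.

Lemma kpolySr a b : kpoly a b.+1 = kpoly a b * (1 + 1 *: 'X).
Proof. by rewrite /kpoly exprSr scale1r mulrA. Qed.

Lemma size_kpoly a b : (size (kpoly a b) <= (a + b).+1)%N.
Proof.
have sM p (c : F) k : (size p <= k.+1)%N -> (size (p * (1 + c *: 'X))%R <= k.+2)%N.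
  move=> sp; apply: leq_trans (size_polyMleq _ _) _.
  have : (size (1 + c *: 'X : {poly F})%R <= 2)%N.
    apply: leq_trans (size_polyD _ _) _; rewrite size_poly1 geq_max /=.
    by apply: leq_trans (size_scale_leq _ _) _; rewrite size_polyX.
  by move: sp; lia.
elim: b => [|b IH]; last by rewrite kpolySr addnS; exact: sM.
elim: a => [|a IH]; last by rewrite kpolySl addSn; exact: sM.
by rewrite /kpoly !expr0 mulr1 size_poly1.
Qed.

(** The degree-[N] homogenisation of [p], evaluated at [(u, v)]: formally
    [v^N p(u / v)], written without division so that [u] and [v] may be
    polynomials. *)
Definition homog (N : nat) p u v : {poly F} :=
  \sum_(i < N.+1) p`_i *: (u ^+ i * v ^+ (N - i)).

(** Homogenisation is multiplicative; with a linear factor at a time this is only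
    an index shift in the sum. *)
Lemma homogM_linear N (c : F) p u v : (size p <= N.+1)%N ->
  homog N.+1 (p * (1 + c *: 'X)) u v = homog N p u v * (v + c *: u).
Proof.
move=> sp; rewrite /homog.
have coefE i : (p * (1 + c *: 'X))`_i = p`_i + c * (if i is j.+1 then p`_j else 0).
  by rewrite mulrDr mulr1 -scalerAr coefD coefZ coefMX; case: i.
under eq_bigr => i _ do rewrite coefE scalerDl.
rewrite big_split /= mulrDr; congr (_ + _).
  rewrite big_ord_recr /= nth_default // scale0r addr0 mulr_suml.
  apply: eq_bigr => i _; rewrite subSn ?exprSr ?mulrA ?scalerAl //.
  by rewrite -ltnS.
rewrite big_ord_recl /= mulr0 scale0r add0r mulr_suml.
apply: eq_bigr => i _; rewrite /bump /= add1n subSS exprS.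
by rewrite -!mul_polyC polyCM; ring.
Qed.

Lemma homog_kpoly a b u v :
  homog (a + b) (kpoly a b) u v = (v - u) ^+ a * (v + u) ^+ b.
Proof.
elim: b => [|b IH].
  elim: a => [|a IH]; first by
    rewrite /homog big_ord1 /kpoly !expr0 !mulr1 coef1 scale1r.
  by rewrite addSn kpolySl homogM_linear ?size_kpoly // IH scaleN1r exprSr; ring.
by rewrite addnS kpolySr homogM_linear ?size_kpoly // IH scale1r [in RHS]exprSr mulrA.
Qed.

Variable n : nat.

Definition kmx : 'M[F]_n.+1 := \matrix_(i, l) (kpoly l (n - l))`_i.

(** Column [b] of the product is a combination of the eigenvector polynomials
    [(1 - X)^l (1 + X)^(n - l)] whose weights are the coefficients of one such
    polynomial: it is a homogenisation at [u = y (1 - X)], [v = x (1 + X)]. *)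
Lemma kmx_diag_kmx (x y : F) (i b : 'I_n.+1) :
  (kmx *m diag_mx (\row_l (x ^+ (n - l) * y ^+ l)) *m kmx) i b =
  ((x *: (1 + 'X) - y *: (1 - 'X)) ^+ b *
   (x *: (1 + 'X) + y *: (1 - 'X)) ^+ (n - b))`_i.
Proof.
rewrite -(homog_kpoly b (n - b) (y *: (1 - 'X))) subnKC ?leq_ord //.
rewrite mxE /homog coef_sum.
apply: eq_bigr => l _; rewrite mul_mx_diag !mxE coefZ !exprZn.
by rewrite -scalerAl -scalerAr scalerA coefZ -/(kpoly _ _); ring.
Qed.

(** At [x = y = 1] the two factors of [kmx_diag_kmx] are [2 X] and [2]. *)
Lemma kmx_sqr : kmx *m kmx = (2 ^+ n)%:M.
Proof.
apply/matrixP => i b.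
have := kmx_diag_kmx 1 1 i b.
have -> : diag_mx (\row_l (1 ^+ (n - l) * 1 ^+ l)) = 1%:M :> 'M[F]_n.+1.
  by apply/matrixP => j k; rewrite !mxE !expr1n mulr1.
rewrite mulmx1 => ->; rewrite !scale1r.
have -> : 1 + 'X - (1 - 'X) = (2%:P * 'X : {poly F}) by rewrite polyC_natr; ring.
have -> : 1 + 'X + (1 - 'X) = (2%:P : {poly F}) by rewrite polyC_natr; ring.
rewrite exprMn mulrAC -exprD subnKC ?leq_ord // -polyC_exp coefCM coefXn mxE.
by rewrite mulr_natr.
Qed.

Lemma kmx_diag_kmx_max (x y : F) (i : 'I_n.+1) :
  (kmx *m diag_mx (\row_l (x ^+ (n - l) * y ^+ l)) *m kmx) i ord_max =
  'C(n, i)%:R * (x + y) ^+ i * (x - y) ^+ (n - i).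
Proof.
rewrite kmx_diag_kmx subnn expr0 mulr1 /=.
have -> : x *: (1 + 'X) - y *: (1 - 'X) = (x - y)%:P + (x + y)%:P * 'X.
  by rewrite -!mul_polyC polyCB polyCD; ring.
rewrite exprDn coef_sum (bigD1 i) //= big1 ?addr0 => [|j ji].
  rewrite exprMn -!polyC_exp coefMn coefCM coefCM coefXn eqxx !mulr1 -[LHS]mulr_natl; ring.
rewrite exprMn -!polyC_exp coefMn coefCM coefCM coefXn eq_sym.
by rewrite (inj_eq val_inj) (negPf ji) !mulr0 mul0rn.
Qed.

(** The eigenvalue equation in generating-function form, from the logarithmic
    derivative [b / (1 + X) - a / (1 - X)]. *)
Lemma kpoly_ode a b : (1 - 'X^2) * (kpoly a b)^`() =
  (b%:R - a%:R - (a + b)%:R * 'X) * kpoly a b.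
Proof.
have dexp (p : {poly F}) k : p * (p ^+ k)^`() = p^`() * k%:R * p ^+ k.
  case: k => [|k]; first by rewrite expr0 derivC; ring.
  by rewrite deriv_exp /= -[X in p * X]mulr_natl exprS; ring.
have da : (1 - 'X) * ((1 - 'X) ^+ a)^`() = - a%:R * (1 - 'X) ^+ a :> {poly F}.
  by rewrite dexp !poly.derivE; ring.
have db : (1 + 'X) * ((1 + 'X) ^+ b)^`() = b%:R * (1 + 'X) ^+ b :> {poly F}.
  by rewrite dexp !poly.derivE; ring.
have -> : 1 - 'X^2 = (1 - 'X) * (1 + 'X) :> {poly F} by ring.
rewrite /kpoly derivM mulrDr.
transitivity ((1 - 'X) * ((1 - 'X) ^+ a)^`() * (1 + 'X) * (1 + 'X) ^+ b +
  (1 + 'X) * ((1 + 'X) ^+ b)^`() * (1 - 'X) * (1 - 'X) ^+ a : {poly F}).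
  by ring.
by rewrite da db natrD; ring.
Qed.

End Krawtchouk.

Lemma map_kmx (F G : fieldType) (f : {rmorphism F -> G}) (n : nat) :
  map_mx f (kmx F n) = kmx G n.
Proof.
apply/matrixP => i l; rewrite !mxE -coef_map; congr (_`_i).
by rewrite rmorphM !rmorphXn rmorphB rmorphD rmorph1 /= map_polyX.
Qed.

(** * Diagonalisation of the Ehrenfest generator and of the spin matrix *)

Lemma coef_tridiag_sum (F : fieldType) (n : nat) (a b c : nat -> F) (p : {poly F})
    (i : 'I_n.+1) : (size p <= n.+1)%N ->
  \sum_(j < n.+1) (if (j == i.+1 :> nat)%N then a j
                   else if (i == j.+1 :> nat)%N then b j
                   else if j == i then c j else 0) * p`_j =
  a i.+1 * p`_i.+1 + (if i : nat is k.+1 then b k * p`_k else 0) + c i * p`_i.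
Proof.
move=> sp.
transitivity (\sum_(j < n.+1 | j == i.+1 :> nat) a j * p`_j +
  \sum_(j < n.+1 | j.+1 == i :> nat) b j * p`_j +
  \sum_(j < n.+1 | j == i :> nat) c j * p`_j).
  rewrite !(big_mkcond (fun _ => _ == _)) /= -!big_split /=; apply: eq_bigr => j _.
  rewrite -val_eqE /= [(i : nat) == _]eq_sym.
  case: eqP => [->|_]; case: eqP => [e|_]; rewrite ?add0r ?addr0 //; first by exfalso; lia.
    by rewrite ifF ?addr0 //; apply/eqP; lia.
    by rewrite ifF ?addr0 //; apply/eqP; lia.
  by case: ifP; rewrite ?mul0r.
congr (_ + _ + _).
- rewrite (big_ord1_eq _ (fun j => a j * p`_j)); case: ltnP => // h.
  by rewrite nth_default ?mulr0 // (leq_trans sp).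
- case: i => -[|k] /= ik; first by rewrite big_pred0.
  under eq_bigl do rewrite eqSS.
  by rewrite (big_ord1_eq _ (fun j => b j * p`_j)) ltnW.
- by rewrite (big_ord1_eq _ (fun j => c j * p`_j)) ltn_ord.
Qed.

Lemma ehrenfestQ_kmx (R : realType) (n : nat) :
  (ehrenfestQ R n)^T *m kmx R n = kmx R n *m diag_mx (\row_l (- 2 * l%:R)).
Proof.
apply/matrixP => i l; rewrite mxE mul_mx_diag !mxE.
have ln : (l <= n)%N := leq_ord l.
set p := kpoly R l (n - l).
have sp : (size p <= n.+1)%N by rewrite -[X in (_ <= X.+1)%N](subnKC ln) size_kpoly.
have dE k : (p^`())`_k = k.+1%:R * p`_k.+1 by rewrite coef_deriv mulr_natl.
transitivity (((1 - 'X^2) * p^`() + (n%:R *: 'X - n%:R%:P) * p)`_i).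
  under eq_bigr => j _ do rewrite !mxE.
  rewrite (coef_tridiag_sum _ _ (fun j => j%:R) (fun j => n%:R - j%:R) (fun=> - n%:R)) //.
  rewrite mulrBl mul1r mulrBl -scalerAl coefD !coefB coefZ coefXM coefXnM coefCM !dE.
  case: (i : nat) => [|[|k]] /=; [ring| |].
    by ring.
  by rewrite !subSS subn0 -/p; ring.
have -> : (1 - 'X^2) * p^`() + (n%:R *: 'X - n%:R%:P) * p = p * (- 2 * l%:R)%:P.
  rewrite kpoly_ode subnKC // natrB // -mul_polyC -/p polyCM polyCN !polyC_natr.
  by ring.
by rewrite coefMC.
Qed.

Definition sqrt_bin (R : realType) (n k : nat) : R := Num.sqrt ('C(n, k)%:R).

Lemma sqrt_bin_neq0 (R : realType) (n : nat) (i : 'I_n.+1) : sqrt_bin R n i != 0.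
Proof. by rewrite sqrtr_eq0 -ltNge ltr0n bin_gt0 leq_ord. Qed.

Definition sqrt_bin_mx (R : realType) (n : nat) : 'M[R]_n.+1 :=
  diag_mx (\row_k sqrt_bin R n k).

Definition sqrt_bin_invmx (R : realType) (n : nat) : 'M[R]_n.+1 :=
  diag_mx (\row_k (sqrt_bin R n k)^-1).

Lemma sqrt_bin_mxV (R : realType) (n : nat) :
  sqrt_bin_mx R n *m sqrt_bin_invmx R n = 1%:M.
Proof.
rewrite mulmx_diag; apply/matrixP => i j.
by rewrite !mxE mulfV ?sqrt_bin_neq0.
Qed.

Lemma sqrt_bin_Vmx (R : realType) (n : nat) :
  sqrt_bin_invmx R n *m sqrt_bin_mx R n = 1%:M.
Proof. by rewrite diag_mxC sqrt_bin_mxV. Qed.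

(** The symmetric tridiagonal matrix with off-diagonal products
    [(k + 1) (n - k)] is the symmetrisation of the Kac matrix
    [Q^T + n] by the square roots of the binomial weights, which form the
    stationary law of the urn.  Entrywise this is the identity
    [(k + 1) C(n, k + 1) = (n - k) C(n, k)] under square roots. *)
Lemma sqrt_bin_spinJx (R : realType) (n : nat) :
  sqrt_bin_mx R n *m (2 *: spinJx R n) =
  ((ehrenfestQ R n)^T + n%:R%:M) *m sqrt_bin_mx R n.
Proof.
pose s := sqrt_bin R n.
apply/matrixP => i j; rewrite mul_mx_diag mul_diag_mx !mxE -!/(s _).
have key k : (k < n)%N ->
    s k.+1 * Num.sqrt ((k%:R + 1) * (n%:R - k%:R)) = (n%:R - k%:R) * s k /\
    s k * Num.sqrt ((k%:R + 1) * (n%:R - k%:R)) = k.+1%:R * s k.+1.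
  move=> kn; rewrite natr1 -natrB ?(ltnW kn) // -natrM /s /sqrt_bin.
  rewrite -[(n - k)%:R]ger0_norm ?ler0n // -[k.+1%:R]ger0_norm ?ler0n //.
  rewrite -!sqrtr_sqr -!sqrtrM ?sqr_ge0 ?ler0n // -!natrX -!natrM.
  by split; congr (Num.sqrt _%:R); have := mul_bin_left n k; nia.
rewrite [i == j]eq_sym; have [ij|ij] := eqVneq j i.
  subst j; rewrite !ifF ?mulr0 ?addNr ?mul0r //; try by apply/eqP; lia.
rewrite mulr0n addr0.
case: (eqVneq (i : nat) j.+1) => [e|_].
  rewrite e ifF; last by apply/eqP; lia.
  by rewrite [2 * _]mulrC mulfVK ?pnatr_eq0 //;
    have [-> _] := key j ltac:(have := leq_ord i; lia).
case: (eqVneq (j : nat) i.+1) => [e|_]; last by rewrite !mulr0 mul0r.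
rewrite e.
by rewrite [2 * _]mulrC mulfVK ?pnatr_eq0 //;
  have [_ ->] := key i ltac:(have := leq_ord j; lia).
Qed.

(** Shifting the eigenvalues [- 2 l] of [Q^T] by [n] and halving gives the spin
    spectrum [n/2 - l]. *)
Lemma spinJx_kmx (R : realType) (n : nat)
    (P : 'M[R]_n.+1 := sqrt_bin_invmx R n *m kmx R n) :
  spinJx R n *m P = P *m diag_mx (\row_l (n%:R / 2 - l%:R)).
Proof.
have two : (2 : R) != 0 by rewrite pnatr_eq0.
apply: (scalerI two); rewrite scalemxAl scalemxAr.
rewrite -[2 *: spinJx R n]mul1mx -sqrt_bin_Vmx -(mulmxA _ _ (2 *: _)).
rewrite sqrt_bin_spinJx /P !mulmxA -(mulmxA _ (sqrt_bin_mx R n)) sqrt_bin_mxV.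
rewrite mulmx1 -!mulmxA; congr (_ *m _).
rewrite mulmxDl ehrenfestQ_kmx mul_scalar_mx -(mul_mx_scalar n%:R) -mulmxDr.
congr (_ *m _); apply/matrixP => i j; rewrite !mxE.
by case: (_ == _); rewrite ?mulr1n ?mulr0n; field.
Qed.

(** * Exponential series on the real and imaginary axes *)

Lemma cvg_exp_series (R : realType) (x : R) :
  (series (fun j => (j`!%:R)^-1 * x ^+ j) @ \oo --> expR x)%classic.
Proof.
rewrite -(exp_coeffE x) /expR; exact: is_cvg_series_exp_coeff.
Qed.

(** [R[i]] is normed over itself, so a radius is a positive complex number; being
    positive it is real, which reduces the claim to the two coordinates. *)
Lemma cvg_complex (R : realType) (U : Type) (F : set_system U) (FF : Filter F)
    (f g : U -> R) (a b : R) (h : U -> (R[i] : numFieldType)) :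
  (forall x, h x = f x +i* g x) ->
  (f @ F --> a)%classic -> (g @ F --> b)%classic ->
  (h @ F --> ((a +i* b) : (R[i] : numFieldType)))%classic.
Proof.
move=> hE fa gb; apply/cvgrPdist_lt => e.
rewrite ltcE /= => /andP[/eqP im0 e0].
have eE : e = (complex.Re e)%:C by rewrite {1}(complexE e) im0 rmorph0 mulr0 addr0.
move/cvgrPdist_lt : fa => /(_ (complex.Re e / 2) ltac:(by rewrite divr_gt0)) fa.
move/cvgrPdist_lt : gb => /(_ (complex.Re e / 2) ltac:(by rewrite divr_gt0)) gb.
near=> x.
have fx : `|a - f x| < complex.Re e / 2 by near: x.
have gx : `|b - g x| < complex.Re e / 2 by near: x.
rewrite hE normc_def eE ltcR /=.
rewrite -[ltRHS](gtr0_norm e0) -sqrtr_sqr ltr_sqrt ?exprn_gt0 //.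
rewrite -(real_normK (num_real (a - f x))) -(real_normK (num_real (b - g x))).
have := normr_ge0 (a - f x); have := normr_ge0 (b - g x).
nra.
Unshelve. all: by end_near. Qed.

Definition cis {R : realType} (y : R) : R[i] := cos y +i* sin y.

Lemma cisD (R : realType) (x y : R) : cis (x + y) = cis x * cis y.
Proof.
rewrite /cis cosD sinD; apply/eqP; rewrite eq_complex /=.
by apply/andP; split; apply/eqP; ring.
Qed.

Lemma cisMn (R : realType) (x : R) k : cis (k%:R * x) = cis x ^+ k.
Proof.
elim: k => [|k IH]; first by rewrite mul0r /cis cos0 sin0.
by rewrite -nat1r mulrDl mul1r cisD IH exprS.
Qed.

Lemma cvg_cis_series (R : realType) (y : R) :
  (series (fun j => (j`!%:R)^-1 * ('i * y%:C) ^+ j) @ \oo -->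
    (cis y : (R[i] : numFieldType)))%classic.
Proof.
apply: (@cvg_complex _ _ _ _ (series (cos_coeff y)) (series (sin_coeff y))).
- move=> N; rewrite /series /=; elim: N => [|N IH]; first by rewrite !big_geq.
  rewrite !big_nat_recr //= IH /cos_coeff /sin_coeff /= exprMn.
  have iE : 'i ^+ N = (~~ odd N)%:R * (-1) ^+ N./2
                      +i* ((odd N)%:R * (-1) ^+ N.-1./2) :> R[i].
    rewrite -[N]odd_double_half; move: (odd N) N./2 => [] m.
      rewrite add1n /= odd_double /= exprS -mul2n exprM sqr_i mul2n doubleK.
      rewrite -[-1](rmorphN1 (real_complex R)) -rmorphXn; apply/eqP; rewrite eq_complex /=.
      by apply/andP; split; apply/eqP; ring.
    rewrite add0n odd_double doubleK -mul2n exprM sqr_i /= mul1r mul0r.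
    by rewrite -[-1](rmorphN1 (real_complex R)) -rmorphXn.
  rewrite iE -rmorphXn -(rmorph_nat (real_complex R)) -fmorphV.
  apply/eqP; rewrite eq_complex /=.
  by apply/andP; split; apply/eqP; congr (_ + _); rewrite -?exprnP; ring.
- rewrite unlock; exact: is_cvg_series_cos_coeff.
- rewrite unlock; exact: is_cvg_series_sin_coeff.
Qed.

(** * The two transition amplitudes *)

(** The balls move independently, each being in urn [a] at time [t] with
    probability [(1 + e^(-2t)) / 2]: the law is binomial. *)
Lemma ehrenfest_law_max (R : realType) (n : nat) (t : R) (k : 'I_n.+1) :
  ehrenfest_law (delta_mx ord_max 0 : 'cV[R]_n.+1) t k 0 =
  'C(n, k)%:R * ((1 + expR (- 2 * t)) / 2) ^+ k
    * ((1 - expR (- 2 * t)) / 2) ^+ (n - k).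
Proof.
have n2 : 2 ^+ n != 0 :> R by rewrite expf_neq0 ?pnatr_eq0.
rewrite /ehrenfest_law (@expmx_diag _ _ _ (kmx R n) ((2 ^+ n)^-1 *: kmx R n)
  (\row_l (- 2 * t * l%:R)) (\row_l (1 ^+ (n - l) * expR (- 2 * t) ^+ l))).
- rewrite -colE mxE -scalemxAr mxE kmx_diag_kmx_max !expr_div_n.
  rewrite -[in (2 ^+ n)^-1](subnKC (leq_ord k)) exprD; field.
  by rewrite !expf_neq0 ?pnatr_eq0.
- by rewrite -scalemxAr kmx_sqr scale_scalar_mx mulVf.
- by rewrite -scalemxAl kmx_sqr scale_scalar_mx mulVf.
- rewrite -scalemxAl ehrenfestQ_kmx scalemxAr; congr (_ *m _).
  by apply/matrixP => i j; rewrite !mxE; case: (_ == _); rewrite ?mulr1n ?mulr0n; ring.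
- move=> l; rewrite !mxE expr1n mul1r -expRM_natr; exact: cvg_exp_series.
Qed.

Lemma braket_entry (R : realType) (n : nat) (U : 'M[R[i]]_n.+1) (j k : 'I_n.+1) :
  braket (j%:R - n%:R / 2) U (k%:R - n%:R / 2) = U j k.
Proof.
have ketE (i : 'I_n.+1) : ket n (i%:R - n%:R / 2 : R) = delta_mx i 0.
  apply/matrixP => a b; rewrite !mxE ord1 eqxx andbT.
  by rewrite (inj_eq (addIr _)) eqr_nat.
by rewrite /braket !ketE trmx_delta map_delta_mx -rowE -colE !mxE.
Qed.

(** The eigenvalue [-i theta (n/2 - l)] exponentiates to
    [x ^ (n - l) * y ^ l] with [x, y = cis (-/+ theta / 2)], and
    [(x + y) / 2], [(x - y) / 2] are [cos (theta / 2)], [- i sin (theta / 2)]. *)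
Lemma spin_rotation_max (R : realType) (n : nat) (theta : R) (k : 'I_n.+1) :
  expmx ((- 'i * theta%:C) *: map_mx (real_complex R) (spinJx R n)) k ord_max =
  (sqrt_bin R n k)%:C * (cos (theta / 2))%:C ^+ k *
    (- 'i * (sin (theta / 2))%:C) ^+ (n - k).
Proof.
have n2 : 2 ^+ n != 0 :> R[i] by rewrite expf_neq0 ?pnatr_eq0.
pose K := kmx R[i] n.
pose toC m n (A : 'M[R]_(m, n)) := map_mx (real_complex R) A.
rewrite (@expmx_diag _ _ _ (toC _ _ (sqrt_bin_invmx R n *m kmx R n))
  ((2 ^+ n)^-1 *: K *m toC _ _ (sqrt_bin_mx R n))
  (\row_l ('i * ((n - l)%:R * (- (theta / 2)) + l%:R * (theta / 2))%:C))
  (\row_l (cis (- (theta / 2)) ^+ (n - l) * cis (theta / 2) ^+ l))).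
- rewrite /toC map_mxM map_kmx -/K !map_diag_mx mulmxA mul_mx_diag mxE.
  rewrite -scalemxAr mxE -!mulmxA mul_diag_mx mxE mulmxA kmx_diag_kmx_max !mxE.
  rewrite [sqrt_bin R n ord_max]/sqrt_bin binn sqrtr1.
  rewrite fmorphV rmorph1 mulr1.
  have -> : cis (- (theta / 2)) + cis (theta / 2) = 2 * (cos (theta / 2))%:C.
    rewrite /cis cosN sinN mulr_natl mulr2n; apply/eqP.
    by rewrite eq_complex /= addNr addr0 !eqxx.
  have -> : cis (- (theta / 2)) - cis (theta / 2) = 2 * (- 'i * (sin (theta / 2))%:C).
    rewrite /cis cosN sinN mulr_natl mulr2n; apply/eqP; rewrite eq_complex /=.
    by apply/andP; split; apply/eqP; ring.
  have CE : 'C(n, k)%:R = (sqrt_bin R n k)%:C ^+ 2.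
    by rewrite -rmorphXn sqr_sqrtr ?ler0n // rmorph_nat.
  have sC : (sqrt_bin R n k)%:C != 0 by rewrite fmorph_eq0 sqrt_bin_neq0.
  rewrite CE !exprMn -[in 2 ^- n](subnKC (leq_ord k)) exprD.
  by field; rewrite sC !expf_neq0 ?pnatr_eq0.
- by rewrite /toC map_mxM map_kmx -mulmxA (mulmxA (kmx _ _)) -scalemxAr kmx_sqr
    scale_scalar_mx mulVf // mul1mx -map_mxM sqrt_bin_Vmx map_mx1.
- by rewrite /toC map_mxM map_kmx -mulmxA (mulmxA (map_mx _ _)) -map_mxM
    sqrt_bin_mxV map_mx1
    mul1mx -scalemxAl kmx_sqr scale_scalar_mx mulVf.
- rewrite -scalemxAl -map_mxM spinJx_kmx map_mxM scalemxAr; congr (_ *m _).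
  apply/matrixP => i l; rewrite !mxE.
  case: (_ == _); rewrite ?mulr1n ?mulr0n ?rmorph0 ?mulr0 //.
  rewrite -mulrA -rmorphM mulNr -mulrN -rmorphN; congr (_ * _%:C).
  by rewrite natrB ?leq_ord //; field.
- move=> l; rewrite !mxE -!cisMn -cisD; exact: cvg_cis_series.
Qed.

Lemma cos_half_sqr (R : realType) (x : R) : cos (x / 2) ^+ 2 = (1 + cos x) / 2.
Proof.
have -> : cos x = cos ((x / 2) *+ 2) by rewrite -mulr_natr divfK ?pnatr_eq0.
by rewrite cos_mulr2n -mulr_natr; field.
Qed.

Lemma sin_half_sqr (R : realType) (x : R) : sin (x / 2) ^+ 2 = (1 - cos x) / 2.
Proof. by rewrite sin2cos2 cos_half_sqr; field. Qed.

Theorem theorem7p10 (R : realType) (n : nat) (hn : (1 <= n)%N) (t : R)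
    (ht : 0 <= t) (k : 'I_n.+1) :
  let pi_ := ehrenfest_law (delta_mx ord_max 0 : 'cV[R]_n.+1) in
  let theta := acos (expR (- 2 * t)) in
  let Jx : 'M[R[i]]_n.+1 := map_mx (real_complex R) (spinJx R n) in
  (pi_ t k 0)%:C =
    `| braket (k%:R - n%:R / 2) (expmx ((- 'i * theta%:C) *: Jx)) (n%:R / 2) | ^+ 2.
Proof.
move=> pi_ theta Jx.
have cosE : cos theta = expR (- 2 * t).
  rewrite /theta acosK // in_itv /= -expR0 ler_expR
    (le_trans _ (expR_ge0 _)) ?lerN10 //=.
  by rewrite mulNr oppr_le0 mulr_ge0.
have half : n%:R / 2 = (@ord_max n)%:R - n%:R / 2 :> R by rewrite /=; field.
rewrite [X in braket _ _ X]half braket_entry spin_rotation_max.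
rewrite /pi_ ehrenfest_law_max -cosE.
rewrite -cos_half_sqr -sin_half_sqr.
have normC (x : R) : `|x%:C| ^+ 2 = (x ^+ 2)%:C :> R[i].
  by rewrite normc_def /= expr0n addr0 sqrtr_sqr -rmorphXn real_normK ?num_real.
have normi : `|- 'i : R[i]| = 1.
  by rewrite normrN normc_def /= expr0n add0r expr1n sqrtr1.
rewrite !normrM !normrX normrM normi mul1r [RHS]exprMn [in RHS]exprMn normC -!exprM.
rewrite ![(_ * 2)%N]mulnC !exprM !normC sqr_sqrtr ?ler0n //.
by rewrite 2!rmorphM !rmorphXn.
Qed.
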